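(* Let $(r_i)_{i\in\mathbb{N}}$ be a sequence of real numbers such that the series $\sum_{i\in\mathbb{N}} r_i$ converges, in the classical sense of analysis, to a real number $r$. Regard each $r_i$ and $r$ as games in surreal canonical representation. Then the infinite game sum $\sum_{i\in\mathbb{N}} r_i$ (defined in the context) is Conway equivalent to $r$, i.e. $-r+\sum_{i\in\mathbb{N}} r_i$ is a second-player win.
   Context: Games are combinatorial games in Conway's sense: possibly infinite, partizan, two-player (Left and Right), perfect information, no chance, no draws, no infinite runs, normal play (a player unable to move loses). A game is written $\{G^L\mid G^R\}$ with $G^L$, $G^R$ ranging over its Left and Right options; $+$ is the disjunctive sum, $-G$ the negative; $G$ and $H$ are Conway equivalent ($G=H$) iff $G-H$ is a second-player win. Surreal canonical representation: a real number $x$ (a surreal number with sign sequence of length $\le\omega$) is represented as the game whose Left options are the surreals (themselves in canonical representation) whose sign sequences are proper initial segments of the sign sequence of $x$ and which are $<x$, and whose Right options are those such initial segments which are $>x$. Infinite sum. For a sequence $(H_i)_{i\in\mathbb{N}}$ of games and $n\in\mathbb{N}$, auxiliary games $(\sum_i H_i)/R,n$ and $(\sum_i H_i)/L,n$ are defined (by transfinite induction on the natural sum of the birthdays of $H_0,\dots,H_n$) as follows. Write $H[i\mapsto K]$ for the sequence obtained from $(H_i)$ by replacing $H_i$ with $K$. $(\sum_i H_i)/R,n=\{\,H_0+\dots+H_{j-1}+H_j^L+H_{j+1}+\dots+H_m \ (m\ge n,\ j\le m)\ \mid\ (\sum H[i\mapsto H_i^R])/R,n\ (i\le n)\,\}$,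 $(\sum_i H_i)/L,n=\{\,(\sum H[i\mapsto H_i^L])/L,n\ (i\le n)\ \mid\ H_0+\dots+H_{j-1}+H_j^R+H_{j+1}+\dots+H_m\ (m\ge n,\ j\le m)\,\}$. Then $\sum_{i\in\mathbb{N}} G_i=\{\,(\sum G[i\mapsto G_i^L])/L,n\ (n\in\mathbb{N},\ i\le n)\ \mid\ (\sum G[i\mapsto G_i^R])/R,n\ (n\in\mathbb{N},\ i\le n)\,\}$. Informally: the first player chooses $n$ and moves on some $G_i$ with $i\le n$ (and may continue moving only on indices $\le n$); as soon as the second player moves, he chooses $m\ge n$ and moves on some index $\le m$, and play continues on the finite sum of the (current positions of) $G_0,\dots,G_m$. *)

(* Defs.v *)
From mathcomp Require Import all_boot all_order all_algebra.
From mathcomp Require Import boolp reals.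
From Stdlib Require Import Wf_nat.
Set Implicit Arguments.
Unset Strict Implicit.
Unset Printing Implicit Defensive.
Import Order.TTheory GRing.Theory Num.Theory.

Declare Scope game_scope.
Delimit Scope game_scope with game.

(* The options are arbitrary small families, so a game may be infinite; being
   an inductive object, it admits no infinite run. *)
Inductive game : Type :=
  Game (Lidx Ridx : Type) (lopt : Lidx -> game) (ropt : Ridx -> game).
Bind Scope game_scope with game.

Definition Lidx (G : game) : Type := let: Game L _ _ _ := G in L.
Definition Ridx (G : game) : Type := let: Game _ R _ _ := G in R.
Definition lopt (G : game) : Lidx G -> game :=
  let: Game _ _ l _ as G := G return Lidx G -> game in l.
Definition ropt (G : game) : Ridx G -> game :=
  let: Game _ _ _ r as G := G return Ridx G -> game in r.
Arguments lopt : clear implicits.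
Arguments ropt : clear implicits.

Fixpoint opp_game (G : game) : game :=
  let: Game L R l r := G in
  Game (fun j : R => opp_game (r j)) (fun i : L => opp_game (l i)).

Fixpoint add_game (G : game) : game -> game :=
  fix add_G (H : game) : game :=
    match G, H with
    | Game GL GR gl gr, Game HL HR hl hr =>
        Game (fun x : GL + HL => match x with
                                 | inl i => add_game (gl i) H
                                 | inr i => add_G (hl i)
                                 end)
             (fun x : GR + HR => match x with
                                 | inl j => add_game (gr j) H
                                 | inr j => add_G (hr j)
                                 end)
    end.

Notation "- G" := (opp_game G) : game_scope.
Notation "G + H" := (add_game G H) : game_scope.
Notation "G - H" := (add_game G (opp_game H)) : game_scope.

(* Normal play: a player who has no option when on move loses. *)
Fixpoint left_wins_first (G : game) : Prop :=
  let: Game L R l r := G in exists i : L, left_wins_second (l i)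
with left_wins_second (G : game) : Prop :=
  let: Game L R l r := G in forall j : R, left_wins_first (r j).

Fixpoint right_wins_first (G : game) : Prop :=
  let: Game L R l r := G in exists j : R, right_wins_second (r j)
with right_wins_second (G : game) : Prop :=
  let: Game L R l r := G in forall i : L, right_wins_first (l i).

Definition second_player_win (G : game) : Prop :=
  left_wins_second G /\ right_wins_second G.

Definition conway_eq (G H : game) : Prop := second_player_win (G - H)%game.

(* [finite_sum H m] is H_0 + ... + H_m, with m + 1 terms. *)
Fixpoint finite_sum (H : nat -> game) (m : nat) : game :=
  if m is m'.+1 then (finite_sum H m' + H m)%game else H 0%N.

Definition replace (H : nat -> game) (i : nat) (K : game) : nat -> game :=
  [eta H with i |-> K].

Definition is_option (K G : game) : Prop :=
  (exists i : Lidx G, K = lopt G i) \/ (exists j : Ridx G, K = ropt G j).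

(* One of the components H_0, ..., H_(n-1) is replaced with one of its options.
   Induction on this relation plays the role of the transfinite induction on
   the natural sum of the birthdays of these components. *)
Definition replace_lt (n : nat) (H' H : nat -> game) : Prop :=
  exists2 i, (i < n)%N & exists2 K, is_option K (H i) & H' = replace H i K.

Lemma is_option_wf : well_founded is_option.
Proof.
elim=> L R l IHl r IHr; split=> K [] [i ->]; [exact: IHl | exact: IHr].
Qed.

Lemma replace_lt_wf (n : nat) : well_founded (replace_lt n).
Proof.
elim: n => [|n IHn] H; first by split=> H' [].
have [G GE] : exists G, H n = G by exists (H n).
elim/(well_founded_ind is_option_wf): G H GE => G IHG H.
elim/(well_founded_ind IHn): H => H IHH GE.
split=> H' [i]; rewrite ltnS leq_eqVlt => /orP[/eqP -> | ltin] [K optK ->].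
  by apply: (IHG K); rewrite -?GE //= /replace /= eqxx.
apply: IHH; first by exists i => //; exists K.
by rewrite /replace /= gtn_eqF.
Qed.

Lemma replace_lt_left (n : nat) (H : nat -> game) (i : 'I_n.+1)
  (a : Lidx (H i)) : replace_lt n.+1 (replace H i (lopt (H i) a)) H.
Proof. by exists (i : nat) => //; eexists; last by []; left; exists a. Qed.

Lemma replace_lt_right (n : nat) (H : nat -> game) (i : 'I_n.+1)
  (a : Ridx (H i)) : replace_lt n.+1 (replace H i (ropt (H i) a)) H.
Proof. by exists (i : nat) => //; eexists; last by []; right; exists a. Qed.

Definition left_move (H : nat -> game) (n : nat) : Type :=
  {i : 'I_n.+1 & Lidx (H i)}.
Definition right_move (H : nat -> game) (n : nat) : Type :=
  {i : 'I_n.+1 & Ridx (H i)}.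

Definition play_left (H : nat -> game) (n : nat) (a : left_move H n) :
    nat -> game :=
  replace H (tag a) (lopt (H (tag a)) (tagged a)).
Definition play_right (H : nat -> game) (n : nat) (a : right_move H n) :
    nat -> game :=
  replace H (tag a) (ropt (H (tag a)) (tagged a)).

(* The auxiliary games written (\sum_i H_i)/R,n and (\sum_i H_i)/L,n; their
   recursive equations are [sum_RE] and [sum_LE] below. *)
Definition sum_R (n : nat) : (nat -> game) -> game :=
  Fix (replace_lt_wf n.+1) (fun _ => game) (fun H rec =>
    Game (fun x : {m : {m : nat | (n <= m)%N} & left_move H (sval m)} =>
            finite_sum (play_left (tagged x)) (sval (tag x)))
         (fun a : right_move H n =>
            rec (play_right a) (replace_lt_right (tagged a)))).

Definition sum_L (n : nat) : (nat -> game) -> game :=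
  Fix (replace_lt_wf n.+1) (fun _ => game) (fun H rec =>
    Game (fun a : left_move H n =>
            rec (play_left a) (replace_lt_left (tagged a)))
         (fun x : {m : {m : nat | (n <= m)%N} & right_move H (sval m)} =>
            finite_sum (play_right (tagged x)) (sval (tag x)))).

Lemma sum_RE (n : nat) (H : nat -> game) :
  sum_R n H =
  Game (fun x : {m : {m : nat | (n <= m)%N} & left_move H (sval m)} =>
          finite_sum (play_left (tagged x)) (sval (tag x)))
       (fun a : right_move H n => sum_R n (play_right a)).
Proof.
rewrite {1}/sum_R Fix_eq // => {}H f g fg.
by congr Game; apply: funext => a; apply: fg.
Qed.

Lemma sum_LE (n : nat) (H : nat -> game) :
  sum_L n H =
  Game (fun a : left_move H n => sum_L n (play_left a))
       (fun x : {m : {m : nat | (n <= m)%N} & right_move H (sval m)} =>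
          finite_sum (play_right (tagged x)) (sval (tag x))).
Proof.
rewrite {1}/sum_L Fix_eq // => {}H f g fg.
by congr Game; apply: funext => a; apply: fg.
Qed.

Definition infinite_sum (G : nat -> game) : game :=
  Game (fun x : {n : nat & left_move G n} =>
          sum_L (tag x) (play_left (tagged x)))
       (fun x : {n : nat & right_move G n} =>
          sum_R (tag x) (play_right (tagged x))).

Inductive sign := Plus | Minus.

(* A sign sequence of length at most omega, padded with [None]. *)
Definition sign_seq := nat -> option sign.

Definition initial_segment (s : sign_seq) (n : nat) : sign_seq :=
  fun k => if (k < n)%N then s k else None.

(* The surreal order on sign sequences is lexicographic, with
   Minus < (end of the sequence) < Plus. *)
Definition sign_rank (a : option sign) : nat :=
  match a with Some Minus => 0 | None => 1 | Some Plus => 2 end.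

Definition surreal_lt (s t : sign_seq) : Prop :=
  exists2 n : nat, (forall k, (k < n)%N -> s k = t k) &
    (sign_rank (s n) < sign_rank (t n))%N.

(* The canonical representation of [initial_segment s n]; see
   [segment_gameE]. *)
Definition segment_game (s : sign_seq) : nat -> game :=
  Fix lt_wf (fun _ => game) (fun n rec =>
    Game (fun k : {k : 'I_n |
              surreal_lt (initial_segment s k) (initial_segment s n)} =>
            rec (sval k) (ssrnat.ltP (ltn_ord (sval k))))
         (fun k : {k : 'I_n |
              surreal_lt (initial_segment s n) (initial_segment s k)} =>
            rec (sval k) (ssrnat.ltP (ltn_ord (sval k))))).

Lemma segment_gameE (s : sign_seq) (n : nat) :
  segment_game s n =
  Game (fun k : {k : 'I_n |
            surreal_lt (initial_segment s k) (initial_segment s n)} =>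
          segment_game s (sval k))
       (fun k : {k : 'I_n |
            surreal_lt (initial_segment s n) (initial_segment s k)} =>
          segment_game s (sval k)).
Proof.
rewrite {1}/segment_game Fix_eq // => {}n f g fg.
by congr Game; apply: funext => k; apply: fg.
Qed.

(* An initial segment smaller or greater than s is automatically proper. *)
Definition canonical_game (s : sign_seq) : game :=
  Game (fun k : {k : nat | surreal_lt (initial_segment s k) s} =>
          segment_game s (sval k))
       (fun k : {k : nat | surreal_lt s (initial_segment s k)} =>
          segment_game s (sval k)).

Section SignExpansion.
Variable R : realType.
Local Open Scope ring_scope.

(* The real value of a node of the tree of finite sign sequences, from the
   values of its greatest smaller ancestor and its least greater ancestor
   ([None] if there is no such ancestor). *)
Definition node_value (lo hi : option R) : R :=
  match lo, hi with
  | None, None => 0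
  | Some a, None => a + 1
  | None, Some b => b - 1
  | Some a, Some b => (a + b) / 2
  end.

(* The ancestors bounding the initial segment of length n of the sign sequence
   of x (all of it, if it is shorter). *)
Fixpoint ancestors (x : R) (n : nat) : option R * option R :=
  if n is n'.+1 then
    let: (lo, hi) := ancestors x n' in
    let d := node_value lo hi in
    if d < x then (Some d, hi) else if x < d then (lo, Some d) else (lo, hi)
  else (None, None).

Definition sign_expansion (x : R) : sign_seq := fun n =>
  let d := node_value (ancestors x n).1 (ancestors x n).2 in
  if d < x then Some Plus else if x < d then Some Minus else None.

Definition real_game (x : R) : game := canonical_game (sign_expansion x).

End SignExpansion.

(* Main.v *)
(* Call a game a number of value v when its moves lose strictly and cheaply
   enough (see [has_value]); such games are closed under sums and negatives, and
   their outcome is the sign of v.  The canonical game of a real number r has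
   value r.

   To see that a player b survives as second player in (sum r_i) - r, or wins
   moving first in (sum x_i) - y when the value is favourable, first suppose that
   all but finitely many terms vanish.  Then b keeps to a winning move of a long
   enough finite sum, where numbers behave as real numbers do.  Otherwise there
   are arbitrarily small nonzero terms, and in each of them b has a move of
   correspondingly small cost.  If the opponent has started the infinite sum, one
   such move, on an index m beyond which the partial sums are close to the limit,
   leads to a favourable finite sum.  If the opponent has moved in - r, what
   remains of it is a game of finite height h; then b starts the infinite sum
   with a bound n covering h + 1 such cheap terms, and answers each further move
   in that game with one of them, while all the partial sums beyond n stay
   favourable. *)

Require Import Defs.
From mathcomp Require Import all_boot all_order all_algebra.
From mathcomp Require Import all_classical all_reals all_analysis.
From mathcomp Require Import ring lra.
Import Order.TTheory GRing.Theory Num.Theory.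
Import numFieldNormedType.Exports.
Local Open Scope classical_set_scope.
Local Open Scope ring_scope.
Set Implicit Arguments.
Unset Strict Implicit.
Unset Printing Implicit Defensive.

(** * Options and outcomes *)

(* The players are booleans, [true] being Left. *)
Definition opt (c : bool) (G K : game) : Prop :=
  if c then exists i, K = lopt G i else exists j, K = ropt G j.

Definition wins_first (c : bool) : game -> Prop :=
  if c then left_wins_first else right_wins_first.

Definition wins_second (c : bool) : game -> Prop :=
  if c then left_wins_second else right_wins_second.

(* [c] is the player who must keep to the indices at most [n]. *)
Definition restricted_sum (c : bool) : nat -> (nat -> game) -> game :=
  if c then sum_L else sum_R.

Lemma opt_is_option c G K : opt c G K -> is_option K G.
Proof. by case: c => -[i ->]; [left | right]; exists i. Qed.

Lemma wins_firstP c G :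
  wins_first c G <-> exists2 K, opt c G K & wins_second c K.
Proof.
case: c G => -[L R l r]; split=> [[i wi]|[_ [i ->] wi]]; try by exists i.
- by exists (l i) => //; exists i.
- by exists (r i) => //; exists i.
Qed.

Lemma wins_secondP c G :
  wins_second c G <-> forall K, opt (~~ c) G K -> wins_first c K.
Proof.
case: c G => -[L R l r]; split=> [w K [i ->]|w i]; try exact: w.
- by apply: (w (r i)); exists i.
- by apply: (w (l i)); exists i.
Qed.

Lemma wins_second_first c G : wins_second c G -> ~ wins_first (~~ c) G.
Proof.
elim/(well_founded_ind is_option_wf): G c => G IH c.
move=> /wins_secondP w2 /wins_firstP[K oK wK].
apply: (IH K (opt_is_option oK) (~~ c) wK).
by rewrite negbK; apply: w2.
Qed.

Lemma opt_add c G H K :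
  opt c (G + H)%game K <->
    (exists2 G', opt c G G' & K = (G' + H)%game) \/
    (exists2 H', opt c H H' & K = (G + H')%game).
Proof.
case: c G H => -[GL GR gl gr] [HL HR hl hr]; split.
- by case=> -[i|i] ->; [left; exists (gl i) | right; exists (hl i)] => //;
    exists i.
- by case=> -[_ [i ->] ->]; [exists (inl i) | exists (inr i)].
- by case=> -[i|i] ->; [left; exists (gr i) | right; exists (hr i)] => //;
    exists i.
- by case=> -[_ [i ->] ->]; [exists (inl i) | exists (inr i)].
Qed.

Lemma opt_opp c G K :
  opt c (- G)%game K <-> exists2 G', opt (~~ c) G G' & K = (- G')%game.
Proof.
case: c G => -[GL GR gl gr]; split=> [[i ->]|[_ [i ->] ->]]; try by exists i.
- by exists (gr i) => //; exists i.
- by exists (gl i) => //; exists i.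
Qed.

Lemma eq_finite_sum (H H' : nat -> game) m :
  (forall i, (i <= m)%N -> H i = H' i) -> finite_sum H m = finite_sum H' m.
Proof.
elim: m => [|m IHm] HH' /=; first exact: HH'.
by rewrite HH' // IHm // => i im; apply: HH'; apply: leqW.
Qed.

Lemma opt_finite_sum c (H : nat -> game) m K :
  opt c (finite_sum H m) K <->
  exists i K', [/\ (i <= m)%N, opt c (H i) K' &
                   K = finite_sum (replace H i K') m].
Proof.
have Er (n : nat) K' : (finite_sum (replace H n.+1 K') n = finite_sum H n).
  apply: eq_finite_sum => i; rewrite -ltnS => /ltn_eqF ni.
  by rewrite /replace /= ni.
elim: m K => [|m IHm] K.
  split=> [oK|[i [K' [+ oK ->]]]]; first by exists 0%N, K.
  by rewrite leqn0 => /eqP i0; rewrite i0 /= /replace /= in oK *.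
rewrite /=; split=> [/opt_add[[_ /IHm[i [K' [im oK' ->]] ->]]|[K' oK' ->]]|].
- exists i, K'; split=> //; first exact: leqW.
  by rewrite /replace /= gtn_eqF.
- by exists m.+1, K'; split=> //; rewrite Er /replace /= eqxx.
case=> i [K' [+ oK' ->]]; rewrite leq_eqVlt => /orP[/eqP ei|].
  rewrite ei in oK' *; rewrite Er {1}/replace /= eqxx.
  by apply/opt_add; right; exists K'.
rewrite ltnS => im; apply/opt_add; left.
exists (finite_sum (replace H i K') m); first by apply/IHm; exists i, K'.
by congr add_game; rewrite /replace /= gtn_eqF.
Qed.

Lemma opt_restricted_sum c n (H : nat -> game) K :
  opt c (restricted_sum c n H) K <->
  exists i K', [/\ (i <= n)%N, opt c (H i) K' &
                   K = restricted_sum c n (replace H i K')].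
Proof.
case: c; rewrite /restricted_sum ?sum_LE ?sum_RE; split.
- case=> -[i a] ->; exists (i : nat), (lopt (H i) a).
  by split=> //; [exact: (ltn_ord i) | exists a].
- case=> i [_ [im [a ->] ->]]; rewrite -ltnS in im.
  by exists (existT _ (Ordinal im) a).
- case=> -[i a] ->; exists (i : nat), (ropt (H i) a).
  by split=> //; [exact: (ltn_ord i) | exists a].
- case=> i [_ [im [a ->] ->]]; rewrite -ltnS in im.
  by exists (existT _ (Ordinal im) a).
Qed.

Lemma opt_restricted_sumN c n (H : nat -> game) K :
  opt (~~ c) (restricted_sum c n H) K <->
  exists m i K', [/\ (n <= m)%N, (i <= m)%N, opt (~~ c) (H i) K' &
                     K = finite_sum (replace H i K') m].
Proof.
case: c; rewrite /restricted_sum ?sum_LE ?sum_RE; split.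
- case=> -[[m nm] [i a]] ->; exists m, (i : nat), (ropt (H i) a).
  by split=> //; [exact: (ltn_ord i) | exists a].
- case=> m [i [_ [nm im [a ->] ->]]]; rewrite -ltnS in im.
  by exists (existT (fun m : {m | (n <= m)%N} => right_move H (sval m))
    (exist _ m nm) (existT _ (Ordinal im) a)).
- case=> -[[m nm] [i a]] ->; exists m, (i : nat), (lopt (H i) a).
  by split=> //; [exact: (ltn_ord i) | exists a].
- case=> m [i [_ [nm im [a ->] ->]]]; rewrite -ltnS in im.
  by exists (existT (fun m : {m | (n <= m)%N} => left_move H (sval m))
    (exist _ m nm) (existT _ (Ordinal im) a)).
Qed.

Lemma opt_infinite_sum c (H : nat -> game) K :
  opt c (infinite_sum H) K <->
  exists n i K', [/\ (i <= n)%N, opt c (H i) K' &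
                     K = restricted_sum c n (replace H i K')].
Proof.
case: c; split.
- case=> -[n [i a]] ->; exists n, (i : nat), (lopt (H i) a).
  by split=> //; [exact: (ltn_ord i) | exists a].
- case=> n [i [_ [im [a ->] ->]]]; rewrite -ltnS in im.
  by exists (existT (left_move H) n (existT _ (Ordinal im) a)).
- case=> -[n [i a]] ->; exists n, (i : nat), (ropt (H i) a).
  by split=> //; [exact: (ltn_ord i) | exists a].
- case=> n [i [_ [im [a ->] ->]]]; rewrite -ltnS in im.
  by exists (existT (right_move H) n (existT _ (Ordinal im) a)).
Qed.

(** * Games with a real value *)

Section Numbers.
Context {R : realType}.
Implicit Types (G H K x y : game) (u v w s : R) (b c : bool) (k m n : nat).

Definition sgn c : R := if c then 1 else -1.

Lemma sgnN c : sgn (~~ c) = - sgn c.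
Proof. by case: c; rewrite /sgn ?opprK. Qed.

Lemma sgnK c v : sgn c * (sgn c * v) = v.
Proof. by case: c; rewrite /sgn; ring. Qed.

(* Every move loses something for the player making it, and each player either
   has arbitrarily cheap moves, or has a move costing at most [2 ^- k] for some
   [k] such that [v] is a multiple of [2 ^- k]; if [k = 0], the latter move is
   only required when [v] favours this player.  Unlike a description of the
   canonical options, this is stable under sums. *)
Inductive has_value (G : game) (v : R) : Prop := HasValue of
  (forall c K, opt c G K -> exists2 u, 0 < sgn c * (v - u) & has_value K u) &
  (forall c,
     (forall k, exists K u, [/\ opt c G K, sgn c * (v - u) <= 2 ^- k &
                           has_value K u])
     \/ (exists2 k, v * 2 ^+ k \is a Num.int &
          (0 < k)%N || (0 < sgn c * v) ->
          exists K u, [/\ opt c G K, sgn c * (v - u) <= 2 ^- k &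
                           has_value K u])).

(** The sign makes positive values favour [b], so that later arguments treat both players at
    once. *)
Definition value_for b (G : game) (v : R) : Prop := has_value G (sgn b * v).

Definition cheap_opt b (G : game) (v e : R) : Prop :=
  exists K u, [/\ opt b G K, v - e <= u & value_for b K u].

Lemma value_for_opt b G K v : value_for b G v -> opt b G K ->
  exists2 u, u < v & value_for b K u.
Proof.
case=> o _ /o[u uv nK]; exists (sgn b * u); last by rewrite /value_for sgnK.
by move: uv; rewrite mulrBr sgnK subr_gt0.
Qed.

Lemma value_for_optN b G K v : value_for b G v -> opt (~~ b) G K ->
  exists2 u, v < u & value_for b K u.
Proof.
case=> o _ /o[u uv nK]; exists (sgn b * u); last by rewrite /value_for sgnK.
by move: uv; rewrite sgnN mulNr mulrBr sgnK oppr_gt0 subr_lt0.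
Qed.

Lemma value_for_rich b G v : value_for b G v ->
  (forall k, cheap_opt b G v (2 ^- k)) \/
  (exists2 k, v * 2 ^+ k \is a Num.int &
     (0 < k)%N || (0 < v) -> cheap_opt b G v (2 ^- k)).
Proof.
have cheap e : (exists K u,
    [/\ opt b G K, sgn b * (sgn b * v - u) <= e & has_value K u]) ->
    cheap_opt b G v e.
  case=> K [u [oK uv nK]]; exists K, (sgn b * u); split=> //.
    by move: uv; rewrite mulrBr sgnK; lra.
  by rewrite /value_for sgnK.
case=> _ /(_ b)[d|[k vk d]]; [left=> k|right; exists k]; first exact: cheap.
  by case: (b) vk; rewrite /sgn ?mul1r // mulN1r mulNr rpredN.
by move=> kv; apply: cheap; apply: d; rewrite sgnK.
Qed.

Lemma intr_pow2_le v k l : (k <= l)%N -> v * 2 ^+ k \is a Num.int ->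
  v * 2 ^+ l \is a Num.int.
Proof.
move=> kl vk; rewrite -(subnKC kl) exprD mulrA.
by rewrite rpredM // rpredX // natr_int.
Qed.

Lemma exists_invr_pow2_lt v : 0 < v -> exists k, 2 ^- k < v.
Proof.
move=> v0; have [N _ /(_ N (leqnn _)) Nv] :=
  near_infty_natSinv_expn_lt (PosNum v0).
by exists N; move: Nv; rewrite /= div1r.
Qed.

Lemma invr_pow2_split k : (2 : R) ^- k = 2 ^- k.+1 + 2 ^- k.+1.
Proof. by rewrite exprSr invfM -splitr. Qed.

Lemma invr_pow2_le_norm v k : v * 2 ^+ k \is a Num.int -> v != 0 ->
  2 ^- k <= `|v|.
Proof.
move=> vk v0; have p2 : 0 < (2 : R) ^+ k by rewrite exprn_gt0.
rewrite -div1r ler_pdivrMr // -(gtr0_norm p2) -normrM norm_intr_ge1 //.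
by rewrite mulf_neq0 // gt_eqF.
Qed.

(** If a player has arbitrarily cheap moves in one summand, so has that player in the sum. Otherwise
    [v + w] is a multiple of the finer of the steps [2 ^- k] and [2 ^- l], and the summand with that
    step provides the move. *)
Lemma has_value_add G H v w :
  has_value G v -> has_value H w -> has_value (G + H)%game (v + w).
Proof.
elim/(well_founded_ind is_option_wf): G H v w => G IHG H.
elim/(well_founded_ind is_option_wf): H => H IHH v w nG nH.
have addG K u : is_option K G -> has_value K u -> has_value (K + H)%game (u + w).
  by move=> oK nK; apply: IHG.
have addH K u : is_option K H -> has_value K u -> has_value (G + K)%game (v + u).
  by move=> oK nK; apply: IHH.
have [oG rG] := nG; have [oH rH] := nH.
split=> [c _ /opt_add[][K oK ->]|c].
- have [u uv nK] := oG c K oK; exists (u + w).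
    by have -> : v + w - (u + w) = v - u by ring.
  exact: addG (opt_is_option oK) nK.
- have [u uw nK] := oH c K oK; exists (v + u).
    by have -> : v + w - (v + u) = w - u by ring.
  exact: addH (opt_is_option oK) nK.
have moveG e :
    (exists K u, [/\ opt c G K, sgn c * (v - u) <= e & has_value K u]) ->
    exists K u, [/\ opt c (G + H)%game K, sgn c * (v + w - u) <= e &
                       has_value K u].
  case=> K [u [oK uv nK]]; exists (K + H)%game, (u + w); split.
  - by apply/opt_add; left; exists K.
  - by have -> : v + w - (u + w) = v - u by ring.
  - exact: addG (opt_is_option oK) nK.
have moveH e :
    (exists K u, [/\ opt c H K, sgn c * (w - u) <= e & has_value K u]) ->
    exists K u, [/\ opt c (G + H)%game K, sgn c * (v + w - u) <= e &
                       has_value K u].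
  case=> K [u [oK uw nK]]; exists (G + K)%game, (v + u); split.
  - by apply/opt_add; right; exists K.
  - by have -> : v + w - (v + u) = w - u by ring.
  - exact: addH (opt_is_option oK) nK.
case: (rG c) => [d|[k vk dG]]; first by left=> k; apply: moveG.
case: (rH c) => [d|[l wl dH]]; first by left=> m; apply: moveH.
right; have [kl|lk] := leqP k l; [exists l|exists k].
- by rewrite mulrDl rpredD // (intr_pow2_le kl).
(* If the finer step is [1], both are, and a sum that favours [c] has a summand that favours [c]. *)
- case: l => [|l] in wl dH kl *; last by move=> _; apply/moveH/dH.
  move: kl; rewrite leqn0 => /eqP k0; rewrite k0 in dG; rewrite /= mulrDr => vw.
  have [v0|v0] := ltP 0 (sgn c * v); first by apply/moveG/dG.
  by apply/moveH/dH; rewrite /=; lra.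
- by rewrite mulrDl rpredD // (intr_pow2_le (ltnW lk)).
- by move=> _; apply/moveG/dG; rewrite (leq_ltn_trans _ lk).
Qed.

Lemma has_value_opp G v : has_value G v -> has_value (- G)%game (- v).
Proof.
elim/(well_founded_ind is_option_wf): G v => G IH v [oG rG].
split=> [c _ /opt_opp[K oK ->]|c].
  have [u uv nK] := oG _ K oK; exists (- u).
    by move: uv; rewrite sgnN; lra.
  exact: IH (opt_is_option oK) _ nK.
have move_opp e :
    (exists K u, [/\ opt (~~ c) G K, sgn (~~ c) * (v - u) <= e &
                   has_value K u]) ->
    exists K u, [/\ opt c (- G)%game K, sgn c * (- v - u) <= e & has_value K u].
  case=> K [u [oK uv nK]]; exists (- K)%game, (- u); split.
  - by apply/opt_opp; exists K.
  - by move: uv; rewrite sgnN; lra.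
  - exact: IH (opt_is_option oK) _ nK.
case: (rG (~~ c)) => [d|[k vk d]]; [left=> k|right; exists k].
- exact: move_opp.
- by rewrite mulNr rpredN.
- by move=> kv; apply/move_opp/d; rewrite sgnN mulNr -mulrN.
Qed.

Lemma value_for_add b G H v w :
  value_for b G v -> value_for b H w -> value_for b (G + H)%game (v + w).
Proof. by rewrite /value_for mulrDr; apply: has_value_add. Qed.

Lemma value_for_opp b G v : value_for b G v -> value_for b (- G)%game (- v).
Proof. by rewrite /value_for mulrN; apply: has_value_opp. Qed.

Lemma value_for_sub b G H v w :
  value_for b G v -> value_for b H w -> value_for b (G - H)%game (v - w).
Proof. by move=> nG nH; apply: value_for_add => //; apply: value_for_opp. Qed.

Lemma value_for_flip b G v : value_for b G v -> value_for (~~ b) G (- v).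
Proof. by rewrite /value_for sgnN mulrNN. Qed.

(** A move of the opponent strictly raises the value seen by [b], so [0 <= v] leaves [b] to move at
    a positive value. There a move costing at most [v] exists, because a positive multiple of
    [2 ^- k] is at least [2 ^- k]. *)
Lemma value_for_outcome b G v : value_for b G v ->
  (0 <= v -> wins_second b G) /\ (0 < v -> wins_first b G).
Proof.
elim/(well_founded_ind is_option_wf): G v => G IH v nG; split=> v0.
  apply/wins_secondP => K oK; have [u vu nK] := value_for_optN nG oK.
  by apply: (IH K (opt_is_option oK) u nK).2; apply: le_lt_trans vu.
suff [K [u [oK u0 nK]]] : cheap_opt b G v v.
  apply/wins_firstP; exists K => //; apply: (IH K (opt_is_option oK) u nK).1.
  by move: u0; rewrite subrr.
have weaken e : e <= v -> cheap_opt b G v e -> cheap_opt b G v v.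
  by move=> ev [K [u [oK vu nK]]]; exists K, u; split=> //; lra.
case: (value_for_rich nG) => [d|[k vk d]].
  have [k kv] := exists_invr_pow2_lt v0.
  exact: weaken (ltW kv) (d k).
apply: weaken (d _); last by rewrite v0 orbT.
by rewrite -[leRHS]gtr0_norm //; apply: invr_pow2_le_norm; rewrite ?gt_eqF.
Qed.

Lemma value_for_wins_second b G v : value_for b G v -> 0 <= v -> wins_second b G.
Proof. by move=> /value_for_outcome[]. Qed.

Lemma value_for_wins_first b G v : value_for b G v -> 0 < v -> wins_first b G.
Proof. by move=> /value_for_outcome[]. Qed.

Lemma value_for_wins_second_ge0 b G v :
  value_for b G v -> wins_second b G -> 0 <= v.
Proof.
move=> nG /wins_second_first w1; rewrite leNgt; apply/negP => v0; apply: w1.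
by apply: value_for_wins_first (value_for_flip nG) _; rewrite oppr_gt0.
Qed.

(** Any step of which the small nonzero [v] is a multiple is finer than [2 ^- k], hence below [1],
    so the move exists whichever player [v] favours. Zero is excluded because the game without
    options has value [0]. *)
Lemma value_for_cheap_opt b G v k : value_for b G v -> v != 0 -> `|v| < 2 ^- k ->
  cheap_opt b G v (2 ^- k).
Proof.
move=> nG v0 vk; case: (value_for_rich nG) => [|[l vl d]]; first exact.
have lv := invr_pow2_le_norm vl v0.
have kl : (k < l)%N.
  have := le_lt_trans lv vk; rewrite ltf_pV2 ?posrE // ltr_eXn2l //.
  by rewrite ltr1n.
have [|K [u [oK vu nK]]] := d; first by rewrite (leq_ltn_trans _ kl).
exists K, u; split=> //; have := le_lt_trans lv vk; lra.
Qed.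

(** Index [m] is left out here, so [finite_sum x m] corresponds to [psum v m.+1]. *)
Definition psum (v : nat -> R) m : R := \sum_(0 <= i < m) v i.

Lemma value_for_finite_sum b (x : nat -> game) (v : nat -> R) m :
  (forall i, value_for b (x i) (v i)) ->
  value_for b (finite_sum x m) (psum v m.+1).
Proof.
move=> nx; elim: m => [|m IHm]; first by rewrite /psum big_nat1; exact: nx.
by rewrite /psum big_nat_recr //=; apply: value_for_add.
Qed.

Definition replacer (v : nat -> R) (i : nat) (u : R) : nat -> R :=
  [eta v with i |-> u].

Lemma value_for_replace b (x : nat -> game) (v : nat -> R) i K u :
  (forall i, value_for b (x i) (v i)) -> value_for b K u ->
  forall j, value_for b (replace x i K j) (replacer v i u j).
Proof. by move=> nx nK j; rewrite /replace /replacer /=; case: eqP. Qed.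

Lemma psum_replacer (v : nat -> R) i u m :
  psum (replacer v i u) m = psum v m + (if (i < m)%N then u - v i else 0).
Proof.
elim: m => [|m IHm]; first by rewrite /psum !big_geq // addr0.
rewrite /psum !big_nat_recr //= -/(psum _ _) -/(psum _ _) IHm /replacer /=.
by rewrite ltnS [m == i]eq_sym; case: ltngtP => [_|_|<-]; ring.
Qed.

Definition sums_to (v : nat -> R) (s : R) : Prop :=
  forall e : R, 0 < e -> exists N, forall m, (N <= m)%N -> `|psum v m - s| < e.

Lemma sums_to_replacer (v : nat -> R) s i u :
  sums_to v s -> sums_to (replacer v i u) (s + (u - v i)).
Proof.
move=> vs e e0; have [N Ns] := vs e e0; exists (maxn N i.+1) => m.
rewrite geq_max => /andP[Nm im]; rewrite psum_replacer im.
by rewrite opprD addrACA subrr addr0; apply: Ns.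
Qed.

End Numbers.

(** * Canonical games of real numbers *)

Section SignExpansions.
Context {R : realType}.
Implicit Types (x v : R) (c : bool) (k n : nat) (p : option R * option R).

Lemma sgn_sub_gt0 c x v : (0 < sgn c * (x - v)) = (if c then v < x else x < v).
Proof. by case: c; rewrite /sgn ?mul1r ?mulN1r ?opprB subr_gt0. Qed.

Definition node x n : R := node_value (ancestors x n).1 (ancestors x n).2.

Lemma ancestorsS x n : ancestors x n.+1 =
  if node x n < x then (Some (node x n), (ancestors x n).2)
  else if x < node x n then ((ancestors x n).1, Some (node x n))
  else ancestors x n.
Proof. by rewrite /node /=; case: (ancestors x n). Qed.

Lemma sign_expansionE x n : sign_expansion x n =
  if node x n < x then Some Plus else if x < node x n then Some Minus else None.
Proof. by []. Qed.

Lemma node_stop x n k : node x n = x -> (n <= k)%N -> node x k = x.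
Proof.
move=> nx; elim: k => [|k IHk]; first by rewrite leqn0 => /eqP <-.
rewrite leq_eqVlt => /orP[/eqP<- //|]; rewrite ltnS => /IHk kx.
by rewrite /node ancestorsS kx ltxx.
Qed.

Lemma sign_expansion_None x n : sign_expansion x n = None <-> node x n = x.
Proof.
by rewrite sign_expansionE; case: ltgtP => [h|h|] //; split=> // e;
  rewrite e ltxx in h.
Qed.

(** The segment has ended at position [k], so the sign of [t] there decides the comparison. Letting
    [t] be cut off beyond [k] covers both the whole expansion and its longer initial segments. *)
Lemma surreal_lt_initial x (t : sign_seq) k :
    (forall i, (i <= k)%N -> t i = sign_expansion x i) ->
    (forall i, t i = None \/ t i = sign_expansion x i) ->
  (surreal_lt (initial_segment (sign_expansion x) k) t <-> node x k < x) /\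
  (surreal_lt t (initial_segment (sign_expansion x) k) <-> x < node x k).
Proof.
move=> tk tN.
have ik : initial_segment (sign_expansion x) k k = None.
  by rewrite /initial_segment ltnn.
have below i : (i < k)%N -> initial_segment (sign_expansion x) k i = t i.
  by move=> ik'; rewrite /initial_segment ik' tk // ltnW.
have above i : (k < i)%N -> t k = None ->
    initial_segment (sign_expansion x) k i = t i.
  move=> ki; rewrite tk // => /sign_expansion_None kx.
  rewrite /initial_segment ltnNge (ltnW ki) /=.
  have [->//|->] := tN i; apply/esym/sign_expansion_None.
  exact: node_stop kx (ltnW ki).
split; split.
- case=> i agree; have [/below->|ki|->] := ltngtP i k; first by rewrite ltnn.
    by rewrite above ?ltnn // -agree.
  by rewrite ik tk // sign_expansionE; case: ltgtP.
- move=> kx; exists k => //; rewrite ik tk // sign_expansionE kx //.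
- case=> i agree; have [/below->|ki|->] := ltngtP i k; first by rewrite ltnn.
    by rewrite above ?ltnn // agree.
  by rewrite ik tk // sign_expansionE; case: ltgtP.
- move=> kx; exists k => [i /below->//|].
  by rewrite ik tk // sign_expansionE kx ltNge (ltW kx).
Qed.

Lemma opt_segment_game x n c K :
  opt c (segment_game (sign_expansion x) n) K <->
  exists k, [/\ (k < n)%N, 0 < sgn c * (x - node x k) &
                K = segment_game (sign_expansion x) k].
Proof.
have agree (k : 'I_n) i : (i <= k)%N ->
    initial_segment (sign_expansion x) n i = sign_expansion x i.
  by move=> ik; rewrite /initial_segment (leq_ltn_trans ik).
have trunc i : initial_segment (sign_expansion x) n i = None \/
    initial_segment (sign_expansion x) n i = sign_expansion x i.
  by rewrite /initial_segment; case: ifP => _; [right | left].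
have lt (k : 'I_n) := surreal_lt_initial (agree k) trunc.
case: c; rewrite /opt segment_gameE; split.
- case=> -[k klt] ->; exists (k : nat); split=> //.
  by rewrite sgn_sub_gt0; apply/(lt k).1.
- case=> k [kn + ->]; rewrite sgn_sub_gt0 => /(lt (Ordinal kn)).1 klt.
  by exists (exist _ (Ordinal kn) klt).
- case=> -[k klt] ->; exists (k : nat); split=> //.
  by rewrite sgn_sub_gt0; apply/(lt k).2.
- case=> k [kn + ->]; rewrite sgn_sub_gt0 => /(lt (Ordinal kn)).2 klt.
  by exists (exist _ (Ordinal kn) klt).
Qed.

Lemma opt_real_game x c K :
  opt c (real_game x) K <->
  exists2 k, 0 < sgn c * (x - node x k) &
             K = segment_game (sign_expansion x) k.
Proof.
have lt k := @surreal_lt_initial x (sign_expansion x) k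
  (fun i _ => erefl) (fun i => or_intror erefl).
case: c; rewrite /opt; split.
- case=> -[k klt] ->; exists (k : nat) => //.
  by rewrite sgn_sub_gt0; apply/(lt k).1.
- by case=> k; rewrite sgn_sub_gt0 => /(lt k).1 klt ->; exists (exist _ k klt).
- case=> -[k klt] ->; exists (k : nat) => //.
  by rewrite sgn_sub_gt0; apply/(lt k).2.
- by case=> k; rewrite sgn_sub_gt0 => /(lt k).2 klt ->; exists (exist _ k klt).
Qed.

Definition ancestor c p : option R := if c then p.1 else p.2.

(** Invariant of the bisection: two ancestors are neighbouring multiples of some [2 ^- j], and a
    lone ancestor is an integer reached by a run of equal signs. *)
Definition dyadic_gap p : Prop :=
  match p with
  | (None, None) => True
  | (Some a, None) => a \is a Num.int /\ 0 <= a
  | (None, Some b) => b \is a Num.int /\ b <= 0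
  | (Some a, Some b) => exists2 j, a * 2 ^+ j \is a Num.int & b = a + 2 ^- j
  end.

(** The last clause is the data required by [has_value]. Bisecting a gap [2 ^- j] gives step
    [2 ^- j.+1], with both ancestors at that distance; any other node is an integer with step [1],
    and has an ancestor at most on the side that its value favours. *)
Lemma dyadic_gap_node p (d := node_value p.1 p.2) : dyadic_gap p ->
  [/\ dyadic_gap (Some d, p.2), dyadic_gap (p.1, Some d) &
      exists2 k, d * 2 ^+ k \is a Num.int & forall c,
        (forall a, ancestor c p = Some a -> 0 < sgn c * (d - a)) /\
        ((0 < k)%N || (0 < sgn c * d) ->
          exists2 a, ancestor c p = Some a & sgn c * (d - a) <= 2 ^- k)].
Proof.
rewrite {}/d; case: p => -[a|] [b|] /=.
- case=> j aj ->; have h0 : 0 < (2 : R) ^- j.+1 by rewrite invr_gt0 exprn_gt0.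
  have hE := @invr_pow2_split R j.
  have -> : (a + (a + 2 ^- j)) / 2 = a + 2 ^- j.+1 by rewrite hE; field.
  have aj1 : a * 2 ^+ j.+1 \is a Num.int by apply: intr_pow2_le aj.
  have dj : (a + 2 ^- j.+1) * 2 ^+ j.+1 \is a Num.int.
    by rewrite mulrDl mulVf ?expf_neq0 // rpredD ?rpred1.
  split; [exists j.+1 => // | exists j.+1 => // | exists j.+1 => // c].
    by rewrite hE addrA.
  case: c; rewrite /ancestor /sgn /=; split.
  - by move=> _ [<-]; lra.
  - by exists a => //; lra.
  - by move=> _ [<-]; rewrite hE; lra.
  - by move=> _; exists (a + 2 ^- j) => //; rewrite hE; lra.
- case=> a_int a0; split.
  - by split; [rewrite rpredD ?rpred1 | lra].
  - by exists 0%N; rewrite ?expr0 ?mulr1 ?invr1.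
  - exists 0%N => [|[]]; rewrite ?expr0 ?mulr1 ?invr1 /= /sgn.
    + by rewrite rpredD ?rpred1.
    + by split=> [_ [<-]|_]; [lra | exists a => //; lra].
    + by split=> //; lra.
- case=> b_int b0; split.
  - exists 0%N; rewrite ?expr0 ?mulr1 ?invr1 ?rpredB ?rpred1 //.
    by rewrite subrK.
  - by split; [rewrite rpredB ?rpred1 | lra].
  - exists 0%N => [|[]]; rewrite ?expr0 ?mulr1 ?invr1 /= /sgn.
    + by rewrite rpredB ?rpred1.
    + by split=> //; lra.
    + by split=> [_ [<-]|_]; [lra | exists b => //; lra].
- move=> _; split; [by split; rewrite ?rpred0 | by split; rewrite ?rpred0 |].
  exists 0%N => [|c]; first by rewrite mul0r rpred0.
  by split; rewrite ?mulr0 ?ltxx //; case: c.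
Qed.

Lemma dyadic_gap_ancestors x n : dyadic_gap (ancestors x n).
Proof.
elim: n => [//|n /[dup] gn /dyadic_gap_node[]]; rewrite ancestorsS.
by case: ltgtP.
Qed.

Lemma ancestorS c x n : ancestor c (ancestors x n.+1) =
  if 0 < sgn c * (x - node x n) then Some (node x n)
  else ancestor c (ancestors x n).
Proof.
by rewrite ancestorsS sgn_sub_gt0; case: c; rewrite /ancestor; case: ltgtP.
Qed.

Lemma ancestor_node c x n a : ancestor c (ancestors x n) = Some a ->
  0 < sgn c * (x - a) /\ exists2 k, (k < n)%N & a = node x k.
Proof.
elim: n => [|n IHn]; first by case: c.
rewrite ancestorS; case: ifP => [xa [<-]|_ /IHn[xa [k kn aE]]].
  by split=> //; exists n.
by split=> //; exists k => //; apply: leqW.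
Qed.

Lemma ancestor_lt_node c x n a : ancestor c (ancestors x n) = Some a ->
  0 < sgn c * (node x n - a).
Proof.
have [_ _ [k _ /(_ c)[lt_a _]]] := dyadic_gap_node (dyadic_gap_ancestors x n).
exact: lt_a.
Qed.

(** After stage [k], the ancestor on this side of [x] is node [k] or a later node nearer to [x];
    node [n] lies strictly beyond it, whichever side of [x] it is on. *)
Lemma lt_node x n k c : (k < n)%N -> 0 < sgn c * (x - node x k) ->
  0 < sgn c * (node x n - node x k).
Proof.
move=> kn xk.
have [a an ka] : exists2 a, ancestor c (ancestors x n) = Some a &
    0 <= sgn c * (a - node x k).
  elim: n kn => [//|n IHn]; rewrite ancestorS ltnS leq_eqVlt.
  case/orP=> [/eqP <-|kn]; first by
    rewrite xk; exists (node x k); rewrite ?subrr ?mulr0 ?lexx.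
  have {kn} [a an ka] := IHn kn; case: ifP => _; last by exists a.
  exists (node x n) => //.
  by have := ancestor_lt_node an; move: ka; lra.
by have := ancestor_lt_node an; move: ka; lra.
Qed.

(** Options are earlier nodes on the side of the mover, strictly worse by [lt_node]; the cheap move
    goes to the current ancestor on that side. *)
Lemma has_value_segment_game x n :
  has_value (segment_game (sign_expansion x) n) (node x n).
Proof.
have [m] := ubnP n; elim: m n => // m IHm n nm.
have value_node k : (k < n)%N ->
    has_value (segment_game (sign_expansion x) k) (node x k).
  by move=> kn; apply: IHm; apply: leq_trans kn _.
split=> [c _ /opt_segment_game[k [kn xk ->]]|c].
  by exists (node x k); [apply: lt_node | apply: value_node].
have [_ _ [k dk rich]] := dyadic_gap_node (dyadic_gap_ancestors x n).
right; exists k => // kd; have [a an da] := (rich c).2 kd.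
have [xa [i ni ai]] := ancestor_node an.
exists (segment_game (sign_expansion x) i), a.
split=> //; last by rewrite ai; apply: value_node.
by apply/opt_segment_game; exists i; rewrite -ai.
Qed.

(** While all signs agree, the nodes run through consecutive integers, so one of them eventually
    passes [x]. *)
Lemma ancestors_both x : (forall n, node x n != x) ->
  exists n a b, ancestors x n = (Some a, Some b).
Proof.
move=> nx.
have sides n : [\/ exists a b, ancestors x n = (Some a, Some b),
    n = 0%N, ancestors x n = (Some (n%:R - 1), None) |
    ancestors x n = (None, Some (1 - n%:R))].
  elim: n => [|n IHn]; first by constructor 2.
  have := nx n; rewrite ancestorsS /node; case: IHn => [[a [b ->]]|->|->|->] /=.
  - by case: ltgtP => // _ _; constructor 1; do 2 eexists.
  - by case: ltgtP => // _ _; [constructor 3 | constructor 4]; rewrite subrr.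
  - case: ltgtP => // _ _; [constructor 3 | by constructor 1; do 2 eexists].
    by rewrite subrK -natr1 addrK.
  - case: ltgtP => // _ _; [by constructor 1; do 2 eexists | constructor 4].
    by rewrite -natr1; congr (_, Some _); ring.
(* For this [n], a lone ancestor [n - 1] or [1 - n] would lie on the wrong side of [x]. *)
set n := (Num.bound `|x|).+2; exists n.
have xn : `|x| < n%:R - 1.
  by rewrite /n -natr1 addrK (lt_trans (archi_boundP (normr_ge0 x))) // ?ltr_nat.
case: (sides n) => [|//||] an; first by [].
  have [] := @ancestor_node true x n (n%:R - 1); first by rewrite an.
  by rewrite /sgn; move: (ler_norm x) xn; lra.
have [] := @ancestor_node false x n (1 - n%:R); first by rewrite an.
by rewrite /sgn; move: (ler_norm (- x)) xn; rewrite normrN; lra.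
Qed.

(** Once both ancestors exist, each further sign halves the gap. *)
Lemma ancestors_gap x j : (forall n, node x n != x) ->
  exists n a i, (j <= i)%N /\ ancestors x n = (Some a, Some (a + 2 ^- i)).
Proof.
move=> nx; elim: j => [|j [n [a [i [ji an]]]]].
  have [n [a [b nab]]] := ancestors_both nx.
  have := dyadic_gap_ancestors x n; rewrite nab => -[i _ bE].
  by exists n, a, i; rewrite -bE.
have hE := @invr_pow2_split R i.
have nE : node x n = a + 2 ^- i.+1 by rewrite /node an /= hE; field.
exists n.+1; have := nx n; rewrite ancestorsS an nE; case: ltgtP => // _ _ /=.
- by exists (a + 2 ^- i.+1), i.+1; split=> //; rewrite hE addrA.
- by exists a, i.+1.
Qed.

(** If some node equals [x], its ancestors give the moves. Otherwise the ancestors close in on [x]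
    from both sides, and both players have arbitrarily cheap moves. *)
Lemma has_value_real_game x : has_value (real_game x) x.
Proof.
split=> [c _ /opt_real_game[k xk ->]|c].
  by exists (node x k) => //; apply: has_value_segment_game.
have option n a : ancestor c (ancestors x n) = Some a ->
    exists2 K, opt c (real_game x) K & has_value K a.
  case/ancestor_node=> xa [k _ aE]; exists (segment_game (sign_expansion x) k).
    by apply/opt_real_game; exists k; rewrite -?aE.
  by rewrite aE; apply: has_value_segment_game.
have [[n nx]|nx] := pselect (exists n, node x n = x).
  right; have [_ _ [k]] := dyadic_gap_node (dyadic_gap_ancestors x n).
  rewrite -/(node x n) nx => xk rich; exists k => // kx.
  have [a /option[K oK nK] xa] := (rich c).2 kx.
  by exists K, a.
left=> j; have [|n [a [i [ji an]]]] := @ancestors_gap x j.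
  by move=> n; apply/eqP => xn; apply: nx; exists n.
have [ax _] : 0 < sgn true * (x - a) /\ exists2 k, (k < n)%N & a = node x k.
  by apply: ancestor_node; rewrite an.
have [xb _] : 0 < sgn false * (x - (a + 2 ^- i)) /\
    exists2 k, (k < n)%N & a + 2 ^- i = node x k.
  by apply: ancestor_node; rewrite an.
have ij : (2 : R) ^- i <= 2 ^- j.
  by rewrite lef_pV2 ?posrE ?exprn_gt0 // ler_eXn2l // ltr1n.
have [|K oK nK] := option n (if c then a else a + 2 ^- i).
  by rewrite an; case: (c).
exists K, (if c then a else a + 2 ^- i); split=> //.
by case: (c); move: ax xb ij; rewrite /sgn; lra.
Qed.

End SignExpansions.

(** * Infinite sums *)

Section InfiniteSums.
Context {R : realType}.
Implicit Types (G K y : game) (x : nat -> game) (v : nat -> R) (w s e u : R).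
Implicit Types (b c : bool) (h i k m n N : nat) (J : seq nat).

Lemma opt_sub c G y K :
  opt c (G - y)%game K <->
    (exists2 G', opt c G G' & K = (G' - y)%game) \/
    (exists2 y', opt (~~ c) y y' & K = (G - y')%game).
Proof.
split=> [/opt_add[]|[[G' oG ->]|[y' oy ->]]].
- by left.
- by case=> _ /opt_opp[y' oy ->] ->; right; exists y'.
- by apply/opt_add; left; exists G'.
- by apply/opt_add; right; exists (- y')%game => //; apply/opt_opp; exists y'.
Qed.

Lemma psum_eventually0 v N m : (forall i, (N <= i)%N -> v i = 0) ->
  (N <= m)%N -> psum v m = psum v N.
Proof.
move=> v0 Nm; rewrite /psum (big_cat_nat (leq0n N) Nm) //=.
rewrite [X in _ + X = _]big_nat_cond [X in _ + X = _]big1 ?addr0 //.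
by move=> i /andP[/andP[Ni _] _]; apply: v0.
Qed.

Lemma sums_to_eventually0 v s N m : sums_to v s ->
  (forall i, (N <= i)%N -> v i = 0) -> (N <= m)%N -> psum v m = s.
Proof.
move=> vs v0 Nm; apply/eqP; rewrite -subr_eq0 -normr_eq0; apply/negPn/negP => d0.
have d_gt0 : 0 < `|psum v m - s| by rewrite lt_neqAle eq_sym d0 /=.
have [M /(_ (maxn M N))] := vs _ d_gt0.
by rewrite !(psum_eventually0 v0) ?leq_maxr // ltxx => /(_ (leq_maxl _ _)).
Qed.

Lemma sums_to_small v s e : sums_to v s -> 0 < e ->
  exists N, forall m, (N <= m)%N -> `|psum v m - s| < e /\ `|v m| < e.
Proof.
(* A term is the difference of two partial sums, each within [e / 2] of the limit. *)
move=> vs e0; have [N Ns] := vs (e / 2) ltac:(by rewrite divr_gt0).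
exists N => m Nm; have sm := Ns m Nm; have sm1 := Ns m.+1 (leqW Nm).
split; first lra.
have -> : v m = (psum v m.+1 - s) - (psum v m - s).
  by rewrite /psum big_nat_recr //=; ring.
by rewrite (le_lt_trans (ler_normB _ _)) // [ltRHS]splitr ltrD.
Qed.

Lemma value_for_finite_sum_sub b x v y w m :
  (forall i, value_for b (x i) (v i)) -> value_for b y w ->
  value_for b (finite_sum x m - y)%game (psum v m.+1 - w).
Proof. by move=> nx ny; apply/value_for_sub/ny/value_for_finite_sum. Qed.

(** A positive value gives a winning move, after which the value is still nonnegative. It serves to
    copy such a move into an infinite sum whose terms eventually vanish. *)
Lemma finite_sum_move b x v y w m :
    (forall i, value_for b (x i) (v i)) -> value_for b y w -> w < psum v m.+1 ->
  (exists i K u, [/\ (i <= m)%N, opt b (x i) K, value_for b K u &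
                     w <= psum (replacer v i u) m.+1]) \/
  (exists y' u, [/\ opt (~~ b) y y', value_for b y' u & u <= psum v m.+1]).
Proof.
move=> nx ny; rewrite -subr_gt0.
move=> /(value_for_wins_first (value_for_finite_sum_sub m nx ny)).
case/wins_firstP=> K oK.
case/opt_sub: oK => [[_ /opt_finite_sum[i [K' [im oK ->]]] ->]|[y' oy ->]] wK.
  left; have [u _ nK] := value_for_opt (nx i) oK; exists i, K', u; split=> //.
  rewrite -subr_ge0; apply: value_for_wins_second_ge0 wK.
  exact: value_for_finite_sum_sub (value_for_replace i nx nK) ny.
right; have [u _ nK] := value_for_optN ny oy; exists y', u; split=> //.
rewrite -subr_ge0; apply: value_for_wins_second_ge0 wK.
exact: value_for_finite_sum_sub.
Qed.

Lemma replace_ltW c n x i K : (i <= n)%N -> opt c (x i) K ->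
  replace_lt n.+1 (replace x i K) x.
Proof. by move=> ni /opt_is_option oK; exists i => //; exists K. Qed.

(** Here the opponent is confined to the indices up to [n], and [b] decides when the sum becomes
    finite. Each opposing move raises the limit or lowers [w]; the induction is on [y], then on the
    first [n.+1] components. *)
Lemma unrestricted_outcome b n y x v w s :
    (forall i, value_for b (x i) (v i)) -> value_for b y w -> sums_to v s ->
  (w <= s -> wins_second b (restricted_sum (~~ b) n x - y)%game) /\
  (w < s -> wins_first b (restricted_sum (~~ b) n x - y)%game).
Proof.
elim/(well_founded_ind is_option_wf): y x v w s => y IHy x.
elim/(well_founded_ind (@replace_lt_wf n.+1)): x => x IHx v w s nx ny vs.
split=> ws.
  apply/wins_secondP => G /opt_sub[[_ /opt_restricted_sum[i [K [ni oK ->]]] ->]|].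
    have [u vu nK] := value_for_optN (nx i) oK.
    have [_ W] := IHx _ (replace_ltW ni oK) _ w _ (value_for_replace i nx nK) ny
      (sums_to_replacer i u vs).
    by apply: W; lra.
  case=> y'; rewrite negbK => oy ->; have [u uw ny'] := value_for_opt ny oy.
  have [_ W] := IHy _ (opt_is_option oy) _ _ _ _ nx ny' vs.
  by apply: W; apply: lt_le_trans ws.
have play m i K u : (n <= m)%N -> (i <= m)%N -> opt b (x i) K ->
    value_for b K u -> w <= psum (replacer v i u) m.+1 ->
    wins_first b (restricted_sum (~~ b) n x - y)%game.
  move=> nm im oK nK wu; apply/wins_firstP.
  exists (finite_sum (replace x i K) m - y)%game.
    apply/opt_sub; left; exists (finite_sum (replace x i K) m) => //.
    rewrite -[b in opt b _ _]negbK; apply/opt_restricted_sumN.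
    by exists m, i, K; rewrite negbK.
  apply: value_for_wins_second
    (value_for_finite_sum_sub m (value_for_replace i nx nK) ny) _.
  by rewrite subr_ge0.
have [[N v0]|v0] := pselect (exists N, forall i, (N <= i)%N -> v i = 0).
  have sE : psum v (maxn N n).+1 = s.
    by apply: sums_to_eventually0 vs v0 _; rewrite leqW // leq_maxl.
  case: (@finite_sum_move b x v y w (maxn N n)) => //; first by rewrite sE.
    by case=> i [K [u [im oK nK wu]]]; apply: play im oK nK wu; rewrite leq_maxr.
  case=> y' [u [oy ny' us]]; apply/wins_firstP.
  exists (restricted_sum (~~ b) n x - y')%game.
    by apply/opt_sub; right; exists y'.
  have [W _] := IHy _ (opt_is_option oy) _ _ _ _ nx ny' vs.
  by apply: W; rewrite -sE.
(* Half of the margin pays for the move, half for the distance of the partial sum from the limit. *)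
have d0 : 0 < (s - w) / 2 by lra.
have [k kd] := exists_invr_pow2_lt d0.
have k0 : 0 < (2 : R) ^- k by rewrite invr_gt0 exprn_gt0.
have [N NS] := sums_to_small vs k0.
(* This term is small enough for a cheap move and late enough for [m = i] to be a legal cut. *)
have [i iN vi0] : exists2 i, (maxn N n <= i)%N & v i != 0.
  apply: contrapT => nv; apply: v0; exists (maxn N n) => i iN.
  by apply/eqP/negPn/negP => vi; apply: nv; exists i.
move: iN; rewrite geq_max => /andP[Ni ni].
have [K [u [oK vu nK]]] := value_for_cheap_opt (nx i) vi0 (NS i Ni).2.
apply: (play i i K u) => //; rewrite psum_replacer ltnSn.
have := (NS i.+1 (leqW Ni)).1; rewrite ltr_norml => /andP[+ _].
move: kd vu; lra.
Qed.

(** Every cut [m] at or above [n] gives the same partial sum, so confinement to the indices up to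
    [n] costs [b] nothing. *)
Lemma restricted_outcome0 b n y x v w :
    (forall i, value_for b (x i) (v i)) -> value_for b y w ->
    (forall i, (n < i)%N -> v i = 0) ->
  (w <= psum v n.+1 -> wins_second b (restricted_sum b n x - y)%game) /\
  (w < psum v n.+1 -> wins_first b (restricted_sum b n x - y)%game).
Proof.
elim/(well_founded_ind is_option_wf): y x v w => y IHy x.
elim/(well_founded_ind (@replace_lt_wf n.+1)): x => x IHx v w nx ny v0.
split=> ws.
  apply/wins_secondP => G.
  case/opt_sub=> [[_ /opt_restricted_sumN[m [i [K [nm im oK ->]]]] ->]|].
    have [u vu nK] := value_for_optN (nx i) oK.
    apply: value_for_wins_first
      (value_for_finite_sum_sub m (value_for_replace i nx nK) ny) _.
    by rewrite psum_replacer ltnS im (psum_eventually0 v0) //; lra.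
  case=> y'; rewrite negbK => oy ->; have [u uw ny'] := value_for_opt ny oy.
  have [_ W] := IHy _ (opt_is_option oy) _ _ _ nx ny' v0.
  by apply: W; apply: lt_le_trans ws.
apply/wins_firstP; case: (finite_sum_move nx ny ws).
  case=> i [K [u [ni oK nK wu]]].
  exists (restricted_sum b n (replace x i K) - y)%game.
    apply/opt_sub; left; exists (restricted_sum b n (replace x i K)) => //.
    by apply/opt_restricted_sum; exists i, K.
  have [|W _] := IHx _ (replace_ltW ni oK) _ _ (value_for_replace i nx nK) ny;
    last exact: W.
  by move=> j nj; rewrite /replacer /= gtn_eqF ?v0 // (leq_ltn_trans ni).
case=> y' [u [oy ny' us]]; exists (restricted_sum b n x - y')%game.
  by apply/opt_sub; right; exists y'.
by have [W _] := IHy _ (opt_is_option oy) _ _ _ nx ny' v0; apply: W.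
Qed.

(** A bound on the length of all runs, alternating or not. The canonical game of a real number with
    infinite expansion has none, but each of its options has one. *)
Fixpoint height_le h (G : game) : Prop :=
  forall K, is_option K G -> if h is h'.+1 then height_le h' K else False.

(* [J] lists components of the sum in which [b] can still move at a cost of at
   most [e]; each of the at most [h] moves of the opponent in [y] is answered in
   one of them. *)
Lemma restricted_wins_second b n h y x v w e J :
    (forall i, value_for b (x i) (v i)) -> value_for b y w -> height_le h y ->
    0 <= e -> uniq J -> size J = h ->
    (forall j, j \in J -> (j <= n)%N /\ cheap_opt b (x j) (v j) e) ->
    (forall m, (n <= m)%N -> w + e * h%:R <= psum v m.+1) ->
  wins_second b (restricted_sum b n x - y)%game.
Proof.
elim: h y x v w J => [|h IHh] y x v w J nx ny yh e0 uJ sJ cJ wS.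
all: apply/wins_secondP => G.
all: case/opt_sub=> [[_ /opt_restricted_sumN[m [i [K [nm im oK ->]]]] ->]|].
1,3: have [u vu nK] := value_for_optN (nx i) oK;
     apply: value_for_wins_first
       (value_for_finite_sum_sub m (value_for_replace i nx nK) ny) _;
     rewrite psum_replacer ltnS im.
- by have := wS m nm; rewrite mulr0; lra.
- have := wS m nm; have : 0 <= e * h.+1%:R by rewrite mulr_ge0.
  lra.
- by case=> y' /opt_is_option/yh.
case=> y'; rewrite negbK => oy ->; have [u uw ny'] := value_for_opt ny oy.
case: J uJ sJ cJ => [//|j J] /= /andP[jJ uJ] [sJ] cJ.
(* The reply costs at most [e], exactly what the required margin drops by when [h.+1] becomes
   [h]. *)
have [nj [K [u' [oK vu nK]]]] := cJ j (mem_head _ _).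
apply/wins_firstP; exists (restricted_sum b n (replace x j K) - y')%game.
  apply/opt_sub; left; exists (restricted_sum b n (replace x j K)) => //.
  by apply/opt_restricted_sum; exists j, K.
apply: (IHh _ _ _ _ J (value_for_replace j nx nK) ny') => //.
- exact: yh (opt_is_option oy).
- move=> i iJ; have ij : (i == j) = false by apply: contraNF jJ => /eqP <-.
  by rewrite /replace /replacer /= ij; apply: cJ; rewrite inE iJ orbT.
- move=> m nm; rewrite psum_replacer ltnS (leq_trans nj nm).
  have := wS m nm; rewrite -natr1 mulrDr mulr1; lra.
Qed.

Lemma infinitely_often_seq (P : nat -> Prop) h :
  (forall N, exists2 i, (N <= i)%N & P i) ->
  forall N, exists2 J, uniq J &
    size J = h /\ forall j, j \in J -> (N <= j)%N /\ P j.
Proof.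
move=> Pi; elim: h => [|h IHh] N; first by exists [::].
have [i Ni Pi'] := Pi N; have [J uJ [sJ JP]] := IHh i.+1.
exists (i :: J) => /=.
  by rewrite uJ andbT; apply/negP => /JP[]; rewrite ltnn.
split=> [|j]; first by rewrite sJ.
rewrite inE => /predU1P[->//|/JP[ij Pj]]; split=> //.
exact: leq_trans Ni (ltnW ij).
Qed.

(** In the second claim [b] may have to open the sum, which calls for a height bound on [y]. The
    first claim appeals to it only after the opponent has moved in [y], so bounds for the options
    are enough. *)
Lemma infinite_sum_outcome b y x v w s :
    (forall i, value_for b (x i) (v i)) -> value_for b y w -> sums_to v s ->
    (forall K, is_option K y -> exists h, height_le h K) ->
  (w <= s -> wins_second b (infinite_sum x - y)%game) /\
  (w < s -> (exists h, height_le h y) -> wins_first b (infinite_sum x - y)%game).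
Proof.
move=> + + vs; elim/(well_founded_ind is_option_wf): y w => y IHy w nx ny yh.
split=> [ws|ws [h hy]].
  apply/wins_secondP => G.
  case/opt_sub=> [[_ /opt_infinite_sum[n [i [K [ni oK ->]]]] ->]|].
    have [u vu nK] := value_for_optN (nx i) oK.
    have [_ W] := unrestricted_outcome n (value_for_replace i nx nK) ny
      (sums_to_replacer i u vs).
    by apply: W; lra.
  case=> y'; rewrite negbK => /[dup] /opt_is_option oy oy' ->.
  have [u uw ny'] := value_for_opt ny oy'; have [h hy'] := yh _ oy.
  have [|_ W] := IHy _ oy u nx ny'.
    by case: h hy' => [|h] hy' K /hy' // hK; exists h.
  by apply: W; [apply: lt_le_trans ws | exists h].
have play n i K : (i <= n)%N -> opt b (x i) K ->
    wins_second b (restricted_sum b n (replace x i K) - y)%game ->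
    wins_first b (infinite_sum x - y)%game.
  move=> ni oK W; apply/wins_firstP.
  exists (restricted_sum b n (replace x i K) - y)%game => //.
  apply/opt_sub; left; exists (restricted_sum b n (replace x i K)) => //.
  by apply/opt_infinite_sum; exists n, i, K.
have [[N v0]|v0] := pselect (exists N, forall i, (N <= i)%N -> v i = 0).
  (* A winning move of the finite sum up to [N] is copied: in the sum, it opens play with bound
     [N]. *)
  have sE : psum v N.+1 = s by apply: sums_to_eventually0 vs v0 _.
  case: (@finite_sum_move b x v y w N) => //; first by rewrite sE.
    case=> i [K [u [iN oK nK wu]]]; apply: (play N i K) => //.
    have [|W _] := restricted_outcome0 (n := N) (value_for_replace i nx nK) ny;
      last exact: W.
    by move=> j Nj; rewrite /replacer /= gtn_eqF ?v0 ?(ltnW Nj) //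
      (leq_ltn_trans iN).
  case=> y' [u [oy ny' us]]; apply/wins_firstP; exists (infinite_sum x - y')%game.
    by apply/opt_sub; right; exists y'.
  have [|W _] := IHy _ (opt_is_option oy) u nx ny'.
    have [h' hy'] := yh _ (opt_is_option oy).
    by case: h' hy' => [|h'] hy' K /hy' // hK; exists h'.
  by apply: W; rewrite -sE.
(* The margin is cut into [h.+2] shares: one for the opening move, [h] for the replies to moves in
   [y], one for the distance of the partial sums from [s]. *)
have d0 : 0 < (s - w) / h.+2%:R by rewrite divr_gt0 // subr_gt0.
have [k kd] := exists_invr_pow2_lt d0; set e : R := 2 ^- k in kd *.
have e0 : 0 < e by rewrite invr_gt0 exprn_gt0.
have {kd d0} we : w + e * h.+1%:R <= s - e.
  move: kd; rewrite ltr_pdivlMr // -natr1 mulrDr mulr1; lra.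
have [N NS] := sums_to_small vs e0.
have vN M : exists2 i, (M <= i)%N & v i != 0.
  apply: contrapT => nv; apply: v0; exists M => i iM.
  by apply/eqP/negPn/negP => vi; apply: nv; exists i.
(* One of these indices opens the sum; the other [h] are kept for replies. *)
have [J uJ [sJ JP]] := infinitely_often_seq h.+1 vN N.
have cheap j : j \in J -> cheap_opt b (x j) (v j) e.
  by move=> /JP[Nj vj]; apply: value_for_cheap_opt vj (NS j Nj).2.
pose n := maxn N (\max_(j <- J) j).
have Jn j : j \in J -> (j <= n)%N.
  by move=> jJ; rewrite leq_max (big_rem j) //= leq_maxl orbT.
case: J uJ sJ cheap {JP} @n Jn => [|j J]; first by move=> _ sJ; discriminate sJ.
rewrite cons_uniq => /andP[jJ uJ] [sJ] cheap n Jn.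
have [K [u [oK vu nK]]] := cheap j (mem_head _ _).
apply: (play n j K) => //; first exact: Jn (mem_head _ _).
apply: (restricted_wins_second (value_for_replace j nx nK) ny hy (ltW e0) uJ sJ).
- move=> i iJ; have ij : (i == j) = false by apply: contraNF jJ => /eqP <-.
  rewrite /replace /replacer /= ij.
  by split; [apply: Jn | apply: cheap]; rewrite inE iJ orbT.
move=> m nm; rewrite psum_replacer ltnS (leq_trans (Jn j (mem_head _ _)) nm).
have Nm : (N <= m.+1)%N by apply: leqW; apply: leq_trans nm; rewrite leq_maxl.
have := (NS _ Nm).1; rewrite ltr_norml => /andP[+ _].
move: we vu; rewrite -natr1 mulrDr mulr1; lra.
Qed.

Lemma height_segment_game (r : R) n k : (k <= n)%N ->
  height_le n (segment_game (sign_expansion r) k).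
Proof.
elim: n k => [|n IHn] k kn K oK.
all: have {oK} [c /opt_segment_game[i [ik _ KE]]] :
  exists c, opt c (segment_game (sign_expansion r) k) K
  by case: oK => o; [exists true | exists false].
  by have := leq_trans ik kn.
by rewrite KE; apply: IHn; rewrite -ltnS (leq_trans ik).
Qed.

Lemma height_option_real_game (r : R) K : is_option K (real_game r) ->
  exists h, height_le h K.
Proof.
move=> oK; have {oK} [c /opt_real_game[k _ ->]] : exists c, opt c (real_game r) K.
  by case: oK => o; [exists true | exists false].
by exists k; apply: height_segment_game.
Qed.

End InfiniteSums.

Theorem theorem3p1 (R : realType) (r_ : nat -> R) (r : R)
    (r_cvg : series r_ @ \oo --> r) :
  conway_eq (infinite_sum (fun i => real_game (r_ i))) (real_game r).
Proof.
(* [value_for b] multiplies by the sign again, and the two signs cancel. *)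
have value b (a : R) : value_for b (real_game a) (sgn b * a).
  by rewrite /value_for sgnK; apply: has_value_real_game.
have sums b : sums_to (fun i => sgn b * r_ i) (sgn b * r).
  move=> e e0; have [N _ Ne] := (@cvgrPdist_lt _ _ _ _ _ _ _).1 r_cvg e e0.
  exists N => m /Ne; rewrite distrC /psum -mulr_sumr -mulrBr normrM.
  by rewrite /sgn; case: (b); rewrite ?normrN normr1 mul1r.
have wins b :
    wins_second b (infinite_sum (fun i => real_game (r_ i)) - real_game r)%game.
  have [W _] := infinite_sum_outcome (fun i => value b (r_ i)) (value b r)
    (sums b) (@height_option_real_game _ r).
  exact: W.
by split; [apply: (wins true) | apply: (wins false)].
Qed.
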